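(* Let $\psi: T \to \mathbb{C}$ be a function and $\varphi: T \to T$ a self-map for which both $C_\varphi$ and $M_\psi$ are bounded on $L_\mu^\infty$. For $w \in T$ let $S_w = \{v \in T : \varphi(v) = \varphi(w)\}$. (a) The operator $C_\varphi$ is an isometry on $L_\mu^\infty$ if and only if $\varphi$ is surjective and $\sup_{v \in S_w} \frac{\mu(v)}{\mu(\varphi(v))} = 1$ for all $w \in T$. (b) The operator $C_\varphi$ is a surjective isometry on $L_\mu^\infty$ if and only if $\varphi$ is a bijection and $\frac{\mu(v)}{\mu(\varphi(v))} = 1$ for all $v \in T$. (c) For the multiplication operator $M_\psi$, the following are equivalent: (i) $M_\psi$ is an isometry on $L_\mu^\infty$; (ii) $M_\psi$ is a surjective isometry on $L_\mu^\infty$; (iii) $|\psi(v)| = 1$ for all $v \in T$.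
   Context: $(T,\mathrm{d})$ is a metric space with a distinguished point $o$ (the root); the length of $v \in T$ is $|v| = \mathrm{d}(o,v)$. $T$ is assumed locally finite (for every $M>0$ the set $\{v \in T : |v| < M\}$ is finite) and unbounded (for every $M>0$ there is $v \in T$ with $|v| \ge M$). $\mu: T \to (0,\infty)$ is an arbitrary positive function (a weight). $L_\mu^\infty$ is the Banach space of functions $f: T \to \mathbb{C}$ with $\|f\|_\mu = \sup_{v \in T} \mu(v)|f(v)| < \infty$. The composition and multiplication operators are the linear maps $C_\varphi f = f\circ\varphi$ and $M_\psi f = \psi f$; such an operator is bounded on $L_\mu^\infty$ if it is a bounded operator from $L_\mu^\infty$ to itself. An operator $A$ on $L_\mu^\infty$ is an isometry if $\|A f\|_\mu = \|f\|_\mu$ for all $f \in L_\mu^\infty$. *)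

(* Defs.v *)
From HB Require Import structures.
From mathcomp Require Import all_boot all_order all_algebra.
From mathcomp Require Import all_classical all_reals ereal topology.
From mathcomp Require Import complex.
Import Order.TTheory GRing.Theory Num.Theory.

Set Implicit Arguments.
Unset Strict Implicit.
Unset Printing Implicit Defensive.

Local Open Scope classical_set_scope.
Local Open Scope ring_scope.
Local Open Scope complex_scope.

(* The modulus as an element of R; the generic norm `|z| lives in R[i]. *)
Notation cmod := ComplexField.Normc.normc.

Section RootedMetricSpace.
Context {R : realType} {T : metricType R} (o : T).

Definition len (v : T) : R := mdist o v.

Definition locally_finite : Prop :=
  forall M : R, 0 < M -> finite_set [set v : T | len v < M].

Definition unbounded : Prop :=
  forall M : R, 0 < M -> exists v : T, M <= len v.

End RootedMetricSpace.

Section WeightedSpace.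
Context {R : realType} {T : Type} (mu : T -> R).

(* Defined on all functions, with value +oo exactly outside L_mu^oo. *)
Definition wnorm (f : T -> R[i]) : \bar R :=
  ereal_sup [set (mu v * cmod (f v))%:E | v in [set: T]].

Definition Lmu : set (T -> R[i]) := [set f | (wnorm f < +oo)%E].

(* An operator on L_mu^oo is given by a linear map on the space of all
   functions T -> C; only its restriction to L_mu^oo is ever constrained. *)
Implicit Type A : {linear (T -> R[i]) -> (T -> R[i])}.

Definition bounded_on_Lmu A : Prop :=
  (forall f, Lmu f -> Lmu (A f)) /\
  exists K : R, forall f, Lmu f -> (wnorm (A f) <= K%:E * wnorm f)%E.

Definition isometry_on_Lmu A : Prop :=
  forall f, Lmu f -> wnorm (A f) = wnorm f.

Definition surjective_isometry_on_Lmu A : Prop :=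
  isometry_on_Lmu A /\
  forall g, Lmu g -> exists2 f, Lmu f & A f = g.

End WeightedSpace.

Section Operators.
Context {R : realType} {T : Type}.

Definition comp_op (phi : T -> T) (f : T -> R[i]) : T -> R[i] := f \o phi.

Definition mul_op (psi : T -> R[i]) (f : T -> R[i]) : T -> R[i] :=
  fun v => psi v * f v.

Fact comp_op_is_linear (phi : T -> T) : linear (comp_op phi).
Proof. by []. Qed.

HB.instance Definition _ (phi : T -> T) :=
  GRing.isLinear.Build R[i] (T -> R[i]) (T -> R[i]) _ (comp_op phi)
    (comp_op_is_linear phi).

Fact mul_op_is_linear (psi : T -> R[i]) : linear (mul_op psi).
Proof.
move=> a f g; apply/funext => v.
by rewrite /mul_op /= mulrDr; congr (_ + _); rewrite mulrCA.
Qed.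

HB.instance Definition _ (psi : T -> R[i]) :=
  GRing.isLinear.Build R[i] (T -> R[i]) (T -> R[i]) _ (mul_op psi)
    (mul_op_is_linear psi).

End Operators.

(* Main.v *)
(** Everything is tested on the point indicators [delta u], whose norm is
    [mu u].  Since [delta u \o phi] is the indicator of the fibre of [phi] over
    [u], the isometry condition at [delta u] says that the supremum of [mu] on
    that fibre is [mu u]; as [mu u > 0] the fibre is nonempty.  Conversely, the
    norm of [f \o phi] may be computed fibre by fibre.  If [comp_op phi] is onto,
    its range separates points, so [phi] is injective and the fibres are
    singletons. *)
Require Import Defs.
From mathcomp Require Import all_boot all_order all_algebra.
From mathcomp Require Import all_classical all_reals ereal topology.
From mathcomp Require Import complex.
Import Order.TTheory GRing.Theory Num.Theory.

Local Open Scope classical_set_scope.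
Local Open Scope ring_scope.
Local Open Scope complex_scope.

Section WeightedNorm.
Context {R : realType} {T : choiceType} (mu : T -> R).
Hypothesis mu_gt0 : forall v, 0 < mu v.
Implicit Types (f : T -> R[i]) (u v w : T).

Lemma cmod_ge0 (z : R[i]) : 0 <= cmod z.
Proof. by case: z => a b; exact: sqrtr_ge0. Qed.

Lemma le_wnorm f v : ((mu v * cmod (f v))%:E <= wnorm mu f)%E.
Proof. by apply: ereal_sup_ubound; exists v. Qed.

Lemma wnorm_le f (M : \bar R) :
  (forall v, ((mu v * cmod (f v))%:E <= M)%E) -> (wnorm mu f <= M)%E.
Proof. by move=> fM; apply: ge_ereal_sup => _ [v _ <-]. Qed.

Lemma eq_wnorm f g :
  (forall v, cmod (f v) = cmod (g v)) -> wnorm mu f = wnorm mu g.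
Proof.
move=> fg; apply/eqP; rewrite eq_le; apply/andP; split; apply: wnorm_le => v.
  by rewrite fg; exact: le_wnorm.
by rewrite -fg; exact: le_wnorm.
Qed.

(** The point [v] witnesses that [T] is inhabited; the supremum of the empty set would be [-oo]. *)
Lemma wnorm_ge0 f v : (0 <= wnorm mu f)%E.
Proof.
by apply: le_trans (le_wnorm f v); rewrite lee_fin mulr_ge0 ?cmod_ge0 ?ltW.
Qed.

Definition delta u : T -> R[i] := fun v => (v == u)%:R.

Lemma cmod_delta u v : cmod (delta u v) = (v == u)%:R.
Proof.
by rewrite /delta; case: eqP => _; [exact: ComplexField.Normc.normc1
  | exact: ComplexField.Normc.normc0].
Qed.

Lemma wnorm_mul_delta (psi : T -> R[i]) u :
  wnorm mu (mul_op psi (delta u)) = (mu u * cmod (psi u))%:E.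
Proof.
apply/eqP; rewrite eq_le; apply/andP; split.
  apply: wnorm_le => v.
  rewrite /mul_op ComplexField.Normc.normcM cmod_delta lee_fin.
  have [->|_] := eqVneq v u; first by rewrite mulr1.
  by rewrite !mulr0 mulr_ge0 ?cmod_ge0 ?ltW.
apply: le_trans (le_wnorm _ u).
by rewrite /mul_op ComplexField.Normc.normcM cmod_delta eqxx mulr1.
Qed.

Lemma wnorm_delta u : wnorm mu (delta u) = (mu u)%:E.
Proof.
have := wnorm_mul_delta (fun=> 1) u.
rewrite ComplexField.Normc.normc1 mulr1 => <-.
by congr wnorm; apply/funext => v; rewrite /mul_op mul1r.
Qed.

Lemma Lmu_delta u : Lmu mu (delta u).
Proof. by rewrite /Lmu /= wnorm_delta ltry. Qed.

Lemma isometry_mul_op (psi : T -> R[i]) :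
  isometry_on_Lmu mu (mul_op psi) <-> forall v, cmod (psi v) = 1.
Proof.
split=> [iso v|psi1 f _].
  have := iso _ (Lmu_delta v); rewrite wnorm_mul_delta wnorm_delta => -[].
  by rewrite -[RHS]mulr1; apply/mulfI; rewrite gt_eqF.
by apply: eq_wnorm => v; rewrite /mul_op ComplexField.Normc.normcM psi1 mul1r.
Qed.

(** Surjectivity comes for free: a unimodular [psi] is pointwise invertible, and dividing [g] by it
    leaves all moduli unchanged, so the preimage stays in [Lmu]. *)
Lemma surjective_isometry_mul_op (psi : T -> R[i]) :
  surjective_isometry_on_Lmu mu (mul_op psi) <-> forall v, cmod (psi v) = 1.
Proof.
split=> [[/isometry_mul_op]//|psi1]; split; first exact/isometry_mul_op.
have psi0 v : psi v != 0.
  apply/eqP => pv0; have := psi1 v; rewrite pv0.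
  by rewrite (ComplexField.Normc.normc0 R) => /eqP; rewrite eq_sym oner_eq0.
move=> g Lg; exists (fun v => (psi v)^-1 * g v); last first.
  by apply/funext => v; rewrite /= /mul_op mulrA divff ?mul1r.
rewrite /Lmu /= (@eq_wnorm _ g)// => v.
by rewrite ComplexField.Normc.normcM ComplexField.Normc.normcV psi1 invr1 mul1r.
Qed.

Section Composition.
Variable phi : T -> T.

(** The denominator is constant on the fibre, so this is the supremum of [mu] there divided by
    [mu (phi w)]. *)
Definition fibre_ratio_sup w : \bar R :=
  ereal_sup [set (mu v / mu (phi v))%:E | v in [set v | phi v = phi w]].

Lemma le_fibre_ratio_sup w v : phi v = phi w ->
  ((mu v / mu (phi v))%:E <= fibre_ratio_sup w)%E.
Proof. by move=> vw; apply: ereal_sup_ubound; exists v. Qed.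

(** The equality includes infinite norms, so it can also be used to show that a function lies in
    [Lmu]. *)
Lemma wnorm_comp_op f : (forall w, exists v, phi v = w) ->
  (forall w, fibre_ratio_sup w = 1%:E) -> wnorm mu (comp_op phi f) = wnorm mu f.
Proof.
move=> surj sup1; apply/eqP; rewrite eq_le; apply/andP; split.
  apply: wnorm_le => v; apply: le_trans (le_wnorm f (phi v)).
  rewrite lee_fin ler_wpM2r ?cmod_ge0//.
  have := le_fibre_ratio_sup v v erefl; rewrite sup1 lee_fin.
  by rewrite ler_pdivrMr// mul1r.
apply: wnorm_le => u; have [w <-] := surj u.
have [fu0|fu0] := eqVneq (cmod (f (phi w))) 0.
  by rewrite fu0 mulr0; exact: wnorm_ge0 u.
have fu_gt0 : 0 < cmod (f (phi w)) by rewrite lt_neqAle eq_sym fu0 cmod_ge0.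
case E : (wnorm mu (comp_op phi f)) => [r||]; last 2 first.
- by rewrite leey.
- by have := wnorm_ge0 (comp_op phi f) u; rewrite E.
(* The supremum need not be attained: the goal is rearranged to have 1 alone on the left, 1 becomes
   the supremum, and each ratio is bounded separately. *)
rewrite lee_fin -ler_pdivlMr// -[leLHS]mul1r -ler_pdivlMr// -lee_fin -(sup1 w).
apply: ge_ereal_sup => _ [v /= vw <-]; rewrite lee_fin vw.
rewrite ler_pM2r ?invr_gt0// ler_pdivlMr//.
by have := le_wnorm (comp_op phi f) v; rewrite E lee_fin /comp_op /= vw.
Qed.

Lemma isometry_comp_op :
  isometry_on_Lmu mu (comp_op phi) <->
  (forall w, exists v, phi v = w) /\ (forall w, fibre_ratio_sup w = 1%:E).
Proof.
split=> [iso|[surj sup1] f _]; last exact: wnorm_comp_op.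
have isod u : wnorm mu (comp_op phi (delta u)) = (mu u)%:E.
  by rewrite iso ?wnorm_delta//; exact: Lmu_delta.
split=> [u|w].
  apply: contrapT => nophi.
  have : ((mu u)%:E <= 0%:E)%E.
    rewrite -isod; apply: wnorm_le => v; rewrite /comp_op /= cmod_delta.
    by case: eqP => [vu|_]; [case: nophi; exists v | rewrite mulr0].
  by rewrite lee_fin leNgt mu_gt0.
apply/eqP; rewrite eq_le; apply/andP; split.
  (* Upper bound: [mu v] is the term at [v] in the norm of [delta (phi v) \o phi]. *)
  apply: ge_ereal_sup => _ [v _ <-].
  rewrite lee_fin ler_pdivrMr// mul1r -lee_fin -(isod (phi v)).
  apply: le_trans (le_wnorm _ v).
  by rewrite /comp_op /= cmod_delta eqxx mulr1.
(* Lower bound: the ratio at [w] itself excludes [-oo] and makes a finite supremum [r] nonnegative,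
   which settles the points off the fibre, where the indicator vanishes. *)
have := le_fibre_ratio_sup w w erefl; have := @le_fibre_ratio_sup w.
case: (fibre_ratio_sup w) => [r||] ub //; last by move=> _; rewrite leey.
rewrite !lee_fin => wr.
have r_ge0 : 0 <= r by apply: le_trans wr; rewrite divr_ge0 ?ltW.
rewrite -(ler_pM2r (mu_gt0 (phi w))) mul1r -lee_fin -(isod (phi w)).
apply: wnorm_le => v; rewrite /comp_op /= cmod_delta lee_fin.
case: eqP => [vw|_]; last by rewrite mulr0 mulr_ge0// ltW.
by have := ub _ vw; rewrite lee_fin vw mulr1 ler_pdivrMr.
Qed.

Lemma fibre_ratio_sup_inj w : injective phi ->
  fibre_ratio_sup w = (mu w / mu (phi w))%:E.
Proof.
move=> inj; rewrite /fibre_ratio_sup.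
rewrite (_ : [set v | phi v = phi w] = [set w]) ?image_set1 ?ereal_sup1//.
by apply/seteqP; split=> [v /inj|v ->].
Qed.

Lemma surjective_isometry_comp_op :
  surjective_isometry_on_Lmu mu (comp_op phi) <->
  bijective phi /\ (forall v, mu v / mu (phi v) = 1).
Proof.
split=> [[/isometry_comp_op[surj sup1] onto]|[[psi phiK psiK] ratio1]].
  have inj : injective phi.
    move=> a b phiab; have [f _ fE] := onto _ (Lmu_delta a).
    have : delta a a = delta a b by rewrite -fE /= /comp_op /= phiab.
    rewrite /delta eqxx; case: eqP => // _ /eqP.
    by rewrite oner_eq0.
  split=> [|v]; last by have := sup1 v; rewrite fibre_ratio_sup_inj// => -[].
  (* Choice gives a right inverse of [phi]; injectivity makes it two-sided. *)
  have [psi psiK] := choice surj.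
  by exists psi => // v; apply: inj; rewrite psiK.
have surj w : exists v, phi v = w by exists (psi w).
have sup1 w : fibre_ratio_sup w = 1%:E.
  by rewrite fibre_ratio_sup_inj ?ratio1//; exact: can_inj phiK.
split; first exact/isometry_comp_op.
move=> g Lg; have gE : comp_op phi (g \o psi) = g.
  by apply/funext => v; rewrite /comp_op /= phiK.
(* The preimage has the same norm as its image [g], hence lies in [Lmu]. *)
by exists (g \o psi) => //; rewrite /Lmu /= -wnorm_comp_op// gE.
Qed.

End Composition.
End WeightedNorm.

Theorem corollary6p4 (R : realType) (T : metricType R) (o : T)
    (T_locally_finite : locally_finite o) (T_unbounded : unbounded o)
    (mu : T -> R) (mu_gt0 : forall v : T, 0 < mu v)
    (psi : T -> R[i]) (phi : T -> T)
    (C_bounded : bounded_on_Lmu mu (comp_op phi))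
    (M_bounded : bounded_on_Lmu mu (mul_op psi)) :
  let S (w : T) : set T := [set v | phi v = phi w] in
  (* (a) *)
  (isometry_on_Lmu mu (comp_op phi) <->
     (forall w : T, exists v : T, phi v = w) /\
     (forall w : T,
        ereal_sup [set (mu v / mu (phi v))%:E | v in S w] = 1%:E)) /\
  (* (b) *)
  (surjective_isometry_on_Lmu mu (comp_op phi) <->
     bijective phi /\ (forall v : T, mu v / mu (phi v) = 1)) /\
  (* (c) *)
  ((isometry_on_Lmu mu (mul_op psi) <->
      surjective_isometry_on_Lmu mu (mul_op psi)) /\
   (surjective_isometry_on_Lmu mu (mul_op psi) <->
      (forall v : T, cmod (psi v) = 1))).
Proof.
move=> S; split; first exact: isometry_comp_op.
split; first exact: surjective_isometry_comp_op.
split; last exact: surjective_isometry_mul_op.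
by rewrite isometry_mul_op// surjective_isometry_mul_op.
Qed.
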